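(* For positive integers $p,q$, \[\mathcal{O}(p,q)=\frac{(-1)^{q}}{2(q-1)!}\left[\int_0^1\frac{\log^{q-1}(x)\,\mathrm{Li}_p(-x)}{x(1-x^2)}\,\mathrm{d}x-\int_0^1\frac{\log^{q-1}(x)\,\mathrm{Li}_p(x)}{x(1-x^2)}\,\mathrm{d}x\right].\]
   Context: $\mathcal{O}_n(p)=\sum_{k=1}^n\frac{1}{(2k-1)^p}$ and $\mathcal{O}(p,q)=\sum_{n=1}^{\infty}\frac{\mathcal{O}_n(p)}{(2n-1)^q}$. $\mathrm{Li}_p(x)=\sum_{m\ge1}x^m/m^p$ is the polylogarithm. *)

(* Defs.v *)
From HB Require Import structures.
From mathcomp Require Import all_boot all_order all_algebra.
From mathcomp Require Import all_classical all_reals all_analysis.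

Set Implicit Arguments.
Unset Strict Implicit.
Unset Printing Implicit Defensive.

Import Order.TTheory GRing.Theory Num.Theory.
Import numFieldNormedType.Exports.

Local Open Scope classical_set_scope.
Local Open Scope ring_scope.

Definition odd_harmonic (R : realType) (p n : nat) : R :=
  \sum_(1 <= k < n.+1) ((2 * k - 1)%N%:R ^+ p)^-1.

(* Extended-real valued: the terms are nonnegative, and the series diverges
   to +oo exactly when q <= 1 (for p > 0). *)
Definition odd_euler_sum (R : realType) (p q : nat) : \bar R :=
  (\sum_(1 <= n <oo) (odd_harmonic R p n / (2 * n - 1)%N%:R ^+ q)%:E)%E.

(* The index is shifted so that the sum starts at x / 1 ^ p.  The limit is
   meaningful for `|x| < 1, the only range in which it is used. *)
Definition polylog (R : realType) (p : nat) (x : R) : R :=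
  limn (series (fun m => x ^+ m.+1 / m.+1%:R ^+ p)).

(* Main.v *)
Require Import Defs.
From HB Require Import structures.
From mathcomp Require Import all_boot all_order all_algebra.
From mathcomp Require Import all_classical all_reals all_analysis.
From mathcomp Require Import ring lra measurable_realfun.

Set Implicit Arguments.
Unset Strict Implicit.
Unset Printing Implicit Defensive.

Import Order.TTheory GRing.Theory Num.Theory.
Import numFieldNormedType.Exports.

Local Open Scope classical_set_scope.
Local Open Scope ring_scope.

(** For 0 < x < 1 and n = q - 1, Cauchy multiplication by 1 / (1 - x^2) gives
    (Li_p(x) - Li_p(-x)) / (x (1 - x^2)) = sum_(k >= 0) 2 O_(k+1)(p) x^(2k).
    Multiply by (- ln x)^n and integrate termwise (Tonelli), using
    int_0^1 x^m (- ln x)^n dx = n! / (m + 1)^(n + 1).  Since Li_p(-x) <= 0 <= Li_p(x),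
    the two integrals on the right-hand side have opposite constant signs, so they
    can be separated in the extended reals even when q = 1, where both diverge. *)

(** * Bounds on odd harmonic sums and convergence of the polylogarithm series *)

Lemma odd_harmonicS (R : realType) p n :
  odd_harmonic R p n.+1 = odd_harmonic R p n + ((2 * n).+1%:R ^+ p)^-1.
Proof. by rewrite /odd_harmonic big_nat_recr//= mulnS addSn add1n subn1. Qed.

Lemma odd_harmonic_ge0 (R : realType) p n : 0 <= odd_harmonic R p n.
Proof. by apply: sumr_ge0 => i _; rewrite invr_ge0 exprn_ge0. Qed.

Lemma invX_natr_le1 (R : realType) p n : (n.+1%:R ^+ p)^-1 <= 1 :> R.
Proof. by rewrite invf_le1 ?exprn_gt0// exprn_ege1// ler1n. Qed.

Lemma odd_harmonic_le (R : realType) p n : odd_harmonic R p n <= n%:R.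
Proof.
elim: n => [|n IHn]; first by rewrite /odd_harmonic big_geq.
by rewrite odd_harmonicS -[n.+1%:R]natr1 lerD// invX_natr_le1.
Qed.

Lemma polylog_is_cvg (R : realType) p (x : R) : `|x| < 1 ->
  cvgn (series (fun m => x ^+ m.+1 / m.+1%:R ^+ p)).
Proof.
move=> x1; apply: normed_cvg.
have x1' : `| `|x| | < 1 by rewrite normr_id.
have g := @is_cvg_geometric_series R 1 _ x1'.
apply: (@series_le_cvg R _ (geometric 1 `|x|)) => [n|n|n|] /=; last exact: g.
- exact: normr_ge0.
- by rewrite mul1r exprn_ge0.
- rewrite mul1r normrM normrX normfV exprS (ger0_norm (exprn_ge0 _ _))//.
  rewrite -[leRHS]mulr1 ler_pM ?mulr_ge0 ?exprn_ge0 ?invr_ge0 ?exprn_ge0//.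
    by rewrite ler_piMl ?exprn_ge0// ltW.
  exact: invX_natr_le1.
Qed.

(** * The generating function of the odd harmonic sums *)

Lemma series_doubleS (R : realType) (u : nat -> R) n :
  series u (2 * n.+1)%N = series u (2 * n)%N + u (2 * n)%N + u (2 * n).+1.
Proof. by rewrite /series/= mulnS !addSn add0n !big_nat_recr//=. Qed.

(** Finite form of the Cauchy product. Even powers cancel in [S x - S (- x)], and multiplication by
    [1 - x ^+ 2] turns the coefficients into increments of [odd_harmonic], which are the odd terms
    of the polylogarithm; the last product is the boundary term of this summation by parts. *)
Lemma polylog_partial_difference (R : realType) p (x : R) n :
  let S (y : R) := series (fun m => y ^+ m.+1 / m.+1%:R ^+ p) in
  x * (1 - x ^+ 2) * \sum_(0 <= i < n) (2 * odd_harmonic R p i.+1 * x ^+ (2 * i)) =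
  S x (2 * n)%N - S (- x) (2 * n)%N - 2 * odd_harmonic R p n * x ^+ (2 * n).+1.
Proof.
move=> S; elim: n => [|n IHn].
  by rewrite /S muln0 /series/= !big_geq// /odd_harmonic big_geq//; ring.
rewrite big_nat_recr//= mulrDr IHn /S !series_doubleS odd_harmonicS.
rewrite (_ : 2 * n.+1 = (2 * n).+2)%N; last by rewrite mulnS.
rewrite ![(- x) ^+ _.+2]exprS ![(- x) ^+ _.+1]exprS !exprM sqrrN -!exprM.
by rewrite ![x ^+ _.+3]exprS ![x ^+ _.+2]exprS ![x ^+ _.+1]exprS; ring.
Qed.

(** Each of the [n] summands in [1 - x^n = (1 - x) (1 + x + ... + x^(n-1))] is at least
    [(1 - x) x^n]. For [x < 1] this bounds [n x^n] uniformly in [n]. *)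
Lemma natr_mulX_le (R : realType) (x : R) n : 0 <= x <= 1 ->
  n%:R * x ^+ n * (1 - x) <= 1 - x ^+ n.
Proof.
move=> /andP[x0 x1]; elim: n => [|n IHn]; first by rewrite !mul0r expr0 subrr.
have y1 : x ^+ n <= 1 by rewrite exprn_ile1.
have y0 : 0 <= x ^+ n by rewrite exprn_ge0.
rewrite -natr1 exprS; move: IHn y1 y0; set y := x ^+ n; set k := n%:R => IHn y1 y0.
have := ler_wpM2l x0 IHn.
(* This product is exactly the slack left after multiplying the induction hypothesis by [x]. *)
have : 0 <= (1 - x) * (1 - x * y).
  by rewrite mulr_ge0 ?subr_ge0// -[leRHS]mulr1 ler_pM.
lra.
Qed.

(** The boundary term vanishes: in [x * x^n * x^n] one factor [x^n] keeps the harmonic sum, at most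
    [n], below [1 / (1 - x)], and the other tends to 0. *)
Lemma odd_harmonic_expr_cvg0 (R : realType) p (x : R) : 0 < x < 1 ->
  odd_harmonic R p n * x ^+ (2 * n).+1 @[n --> \oo] --> 0.
Proof.
move=> /andP[x0 x1].
have xn1 : `|x| < 1 by rewrite ger0_norm// ltW.
have h : (fun n => (1 - x)^-1 * x ^+ n) @ \oo --> 0.
  rewrite -[X in _ --> X](mulr0 (1 - x)^-1); apply: cvgM; first exact: cvg_cst.
  exact: cvg_expr.
apply: (squeeze_cvgr _ (cvg_cst 0) h); apply: nearW => n /=.
rewrite mulr_ge0 ?odd_harmonic_ge0 ?exprn_ge0 ?(ltW x0)//=.
rewrite mulnC exprS exprM expr2.
have xn0 : 0 <= x ^+ n by rewrite exprn_ge0// ltW.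
have xnle1 : x ^+ n <= 1 by rewrite exprn_ile1// ltW.
have nx : odd_harmonic R p n * x ^+ n <= (1 - x)^-1.
  rewrite -div1r ler_pdivlMr ?subr_gt0//.
  apply: (@le_trans _ _ (n%:R * x ^+ n * (1 - x))).
    by rewrite !ler_wpM2r ?odd_harmonic_le ?subr_ge0 ?(ltW x1).
  apply: (le_trans (natr_mulX_le _ _)); first by rewrite !ltW.
  by rewrite gerBl.
rewrite (_ : _ * _ = x * (odd_harmonic R p n * x ^+ n) * x ^+ n); last by ring.
apply: ler_wpM2r => //; apply: le_trans nx.
by apply: ler_piMl; [rewrite mulr_ge0// odd_harmonic_ge0|exact: ltW].
Qed.

Lemma cvgn_double (R : realType) (u : nat -> R) (l : R) :
  u @ \oo --> l -> u (2 * n)%N @[n --> \oo] --> l.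
Proof.
move=> ul; apply: (cvg_comp _ _ _ ul) => /=.
apply/cvgnyPge => A; exists A => // n /= An.
by rewrite (leq_trans An)// leq_pmull.
Qed.

Lemma polylog_difference_cvg (R : realType) p (x : R) : 0 < x < 1 ->
  \sum_(0 <= i < n) (2 * odd_harmonic R p i.+1 * x ^+ (2 * i)) @[n --> \oo]
    --> (polylog p x - polylog p (- x)) / (x * (1 - x ^+ 2)).
Proof.
move=> x01; have /andP[x0 x1] := x01.
have D0 : x * (1 - x ^+ 2) != 0.
  by rewrite mulf_neq0 ?gt_eqF// subr_gt0 expr_lt1// ltW.
have xn1 : `|x| < 1 by rewrite ger0_norm// ltW.
have xNn1 : `|- x| < 1 by rewrite normrN.
pose S (y : R) n := series (fun m => y ^+ m.+1 / m.+1%:R ^+ p) n.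
have sumE n : \sum_(0 <= i < n) (2 * odd_harmonic R p i.+1 * x ^+ (2 * i)) =
    (S x (2 * n)%N - S (- x) (2 * n)%N
      - 2 * (odd_harmonic R p n * x ^+ (2 * n).+1)) / (x * (1 - x ^+ 2)).
  by rewrite mulrA -polylog_partial_difference mulrAC mulfV// mul1r.
(* The added [2 * 0] is the limit of the boundary term in [sumE]. *)
rewrite (eq_cvg _ _ sumE) (_ : polylog p x - polylog p (- x) =
  polylog p x - polylog p (- x) - 2 * 0); last by rewrite mulr0 subr0.
apply: cvgM; last exact: cvg_cst.
apply: cvgB; first apply: cvgB.
- exact: cvgn_double (polylog_is_cvg xn1).
- exact: cvgn_double (polylog_is_cvg xNn1).
- by apply: cvgM; [exact: cvg_cst|exact: odd_harmonic_expr_cvg0].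
Qed.

(** * Signs of the polylogarithm on both sides of 0 *)

Lemma polylog_ge0 (R : realType) p (x : R) : 0 <= x < 1 -> 0 <= polylog p x.
Proof.
move=> /andP[x0 x1]; apply: limr_ge.
  by apply: polylog_is_cvg; rewrite ger0_norm.
apply: nearW => n; apply: sumr_ge0 => i _.
by rewrite divr_ge0// exprn_ge0.
Qed.

(** The series alternates with terms of decreasing size, starting with a nonpositive one. Grouping
    them in pairs makes every even partial sum nonpositive, and these already determine the
    limit. *)
Lemma polylogN_le0 (R : realType) p (x : R) : 0 <= x < 1 -> polylog p (- x) <= 0.
Proof.
move=> /andP[x0 x1].
have cv : cvgn (series (fun m => (- x) ^+ m.+1 / m.+1%:R ^+ p)).
  by apply: polylog_is_cvg; rewrite normrN ger0_norm.
apply: (cvgr_to_le (cvgn_double cv)); apply: nearW => n.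
elim: n => [|n IHn]; first by rewrite muln0 /series/= big_geq.
rewrite series_doubleS -addrA -[leRHS]addr0 lerD//.
rewrite [(- x) ^+ _.+2]exprS ![(- x) ^+ _.+1]exprS exprM sqrrN -exprM.
rewrite mulrA mulrNN mulNr mulNr addrC subr_le0.
have y0 : 0 <= x ^+ (2 * n) by rewrite exprn_ge0.
rewrite ler_pM ?mulr_ge0 ?invr_ge0 ?exprn_ge0//.
  by rewrite -mulrA ler_piMl ?mulr_ge0// ltW.
by rewrite lef_pV2 ?posrE ?exprn_gt0// lerXn2r ?nnegrE// ler_nat.
Qed.

(** * The logarithmic moments of the unit interval *)

(** The recursion is integration by parts: differentiating [(- ln x) ^+ n] lowers the power by one
    and yields a factor [- n / x], which brings [x ^+ m.+1] back to [x ^+ m]. *)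
Fixpoint expr_ln_primitive (R : realType) m n (x : R) : R :=
  (x ^+ m.+1 * (- ln x) ^+ n +
   if n is k.+1 then n%:R * expr_ln_primitive m k x else 0) / m.+1%:R.

Lemma is_derive_expr_ln_primitive (R : realType) m n (x : R) : 0 < x ->
  is_derive x 1 (expr_ln_primitive m n) (x ^+ m * (- ln x) ^+ n).
Proof.
move=> x0; have x0' : x != 0 by rewrite gt_eqF.
have dl := is_derive1_ln x0.
elim: n => [|n IHn].
  have h : is_derive x 1 (m.+1%:R^-1 *: (@id R ^+ m.+1)) (x ^+ m * (- ln x) ^+ 0).
    apply: is_derive_eq; rewrite /GRing.scale/= expr0 !mulr1.
    by rewrite mulrA mulVf// mul1r.
  suff -> : expr_ln_primitive m 0 = m.+1%:R^-1 *: (@id R ^+ m.+1) by [].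
  by apply/funext => y; rewrite !fctE/= expr0 mulr1 addr0 mulrC.
(* The differentiation rules apply to sums and products of functions, so the primitive is first
   written as such a combination. *)
have h : is_derive x 1 (m.+1%:R^-1 *:
   (@id R ^+ m.+1 * (- @ln R) ^+ n.+1 + n.+1%:R *: expr_ln_primitive m n))
   (x ^+ m * (- ln x) ^+ n.+1).
  apply: is_derive_eq; rewrite !fctE /GRing.scale/=.
  have m0 : (1 + m%:R : R) != 0 by rewrite nat1r.
  rewrite !exprS -!nat1r; field.
  by rewrite x0' m0.
suff -> : expr_ln_primitive m n.+1 = m.+1%:R^-1 *:
   (@id R ^+ m.+1 * (- @ln R) ^+ n.+1 + n.+1%:R *: expr_ln_primitive m n) by [].
by apply/funext => y; rewrite !fctE /GRing.scale/= mulrC.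
Qed.

Lemma integral_expr_ln_segment (R : realType) m n (a : R) : 0 < a < 1 ->
  (\int[@lebesgue_measure R]_(x in `[a, 1%R]) (x ^+ m * (- ln x) ^+ n)%:E =
   (expr_ln_primitive m n 1)%:E - (expr_ln_primitive m n a)%:E)%E.
Proof.
move=> /andP[a0 a1].
have d x : 0 < x -> derivable (expr_ln_primitive m n) x 1.
  by move=> x0; have [] := is_derive_expr_ln_primitive m n x0.
have c x : 0 < x -> {for x, continuous (expr_ln_primitive m n)}.
  by move=> x0; apply/differentiable_continuous/derivable1_diffP/d.
apply: continuous_FTC2 => //.
- apply: derivable_within_continuous => x; rewrite in_itv/= => /andP[ax _].
  have x0 : 0 < x by exact: lt_le_trans ax.
  have dl := is_derive1_ln x0.
  have h : derivable (@id R ^+ m * (- @ln R) ^+ n) x 1 by exact: ex_derive.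
  suff -> : (fun y => y ^+ m * (- ln y) ^+ n) = @id R ^+ m * (- @ln R) ^+ n by [].
  by apply/funext => y; rewrite !fctE.
- split.
  + by move=> x; rewrite in_itv/= => /andP[ax _]; apply/d/(lt_trans a0).
  + exact/cvg_at_right_filter/c.
  + exact/cvg_at_left_filter/c.
- move=> x; rewrite in_itv/= => /andP[ax _].
  have x0 : 0 < x by exact: lt_trans ax.
  by rewrite derive1E; have [] := is_derive_expr_ln_primitive m n x0.
Qed.

Lemma expr_ln_primitive1 (R : realType) m n :
  expr_ln_primitive m n (1 : R) = n`!%:R / m.+1%:R ^+ n.+1.
Proof.
elim: n => [|n IHn]; first by rewrite /= expr1n mulr1 addr0 expr1.
rewrite [LHS]/= IHn ln1 oppr0 expr0n/= mulr0 add0r.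
by rewrite factS natrM [_ ^+ n.+2]exprS invfM; ring.
Qed.

(** With [t = k + 1], the exponential dominates one term of its series, [t^(n+1) / (n+1)! <= e^t];
    the remaining powers of [e^(-t)] are at most 1. *)
Lemma expR_natN_exprn_le (R : realType) m n k :
  (expR (- k.+1%:R) : R) ^+ m.+1 * k.+1%:R ^+ n <= n.+1`!%:R / k.+1%:R.
Proof.
set t : R := k.+1%:R; have t0 : 0 < t by rewrite ltr0n.
have f0 : 0 < n.+1`!%:R :> R by rewrite ltr0n fact_gt0.
have e1 : expR (- t) <= n.+1`!%:R / t ^+ n.+1.
  rewrite expRN -[leRHS]invf_div lef_pV2 ?posrE ?expR_gt0 ?divr_gt0 ?exprn_gt0//.
  by apply: le_trans (expR_ge1Dxn n (ltW t0)); rewrite lerDr.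
have e2 : expR (- t) ^+ m.+1 <= expR (- t).
  rewrite exprS ler_piMr ?expR_ge0// exprn_ile1 ?expR_ge0//.
  by rewrite -expR0 ler_expR oppr_le0 ltW.
apply: (@le_trans _ _ (n.+1`!%:R / t ^+ n.+1 * t ^+ n)).
  by rewrite ler_wpM2r ?exprn_ge0 ?(ltW t0)// (le_trans e2).
by rewrite exprS invfM mulrA mulfVK// expf_neq0// gt_eqF.
Qed.

(** The primitive has no boundary contribution at 0. Along the points [e^(-(k+1))] the factor
    [- ln x] is just [k + 1]. *)
Lemma expr_ln_primitive_cvg0 (R : realType) m n :
  expr_ln_primitive m n (expR (- k.+1%:R) : R) @[k --> \oo] --> 0.
Proof.
have c i : (expR (- k.+1%:R) : R) ^+ m.+1 * k.+1%:R ^+ i @[k --> \oo] --> 0.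
  have h : i.+1`!%:R * harmonic k @[k --> \oo] --> (0 : R).
    rewrite -[X in _ --> X](mulr0 (i.+1`!%:R : R)).
    by apply: cvgM; [exact: cvg_cst|exact: cvg_harmonic].
  apply: (squeeze_cvgr _ (cvg_cst 0) h); apply: nearW => k /=.
  by rewrite mulr_ge0 ?exprn_ge0 ?expR_ge0//= expR_natN_exprn_le.
(* One level of the recursion, [u] standing for the lower-order part. *)
have E i (u : nat -> R) : u @ \oo --> 0 ->
    ((expR (- k.+1%:R) : R) ^+ m.+1 * (- ln (expR (- k.+1%:R))) ^+ i + u k) /
      m.+1%:R @[k --> \oo] --> 0.
  move=> u0; rewrite -[X in _ --> X](mul0r (m.+1%:R^-1 : R)).
  apply: cvgM; last exact: cvg_cst.
  rewrite -[X in _ --> X](addr0 (0 : R)); apply: cvgD => //.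
  by under eq_cvg do rewrite expRK opprK; exact: c.
elim: n => [|n IHn]; first by apply: E; exact: cvg_cst.
apply: E; rewrite -[X in _ --> X](mulr0 (n.+1%:R : R)).
by apply: cvgM => //; exact: cvg_cst.
Qed.

Lemma measurable_expr_ln (R : realType) m n (D : set R) :
  measurable_fun D (fun x : R => x ^+ m * (- ln x) ^+ n).
Proof.
apply: measurable_funM; first exact: measurable_funX.
apply: measurable_funX; apply: measurableT_comp => //.
exact: measurable_funS measurableT (@subsetT _ D) (@measurable_ln R).
Qed.

(** Monotone convergence along the segments [F k], which avoid the singularity at 0 and increase to
    the interval closed at 1; on each of them the fundamental theorem of calculus applies. *)
Lemma integral_expr_ln (R : realType) m n :
  (\int[@lebesgue_measure R]_(x in `]0%R, 1%R[) (x ^+ m * (- ln x) ^+ n)%:E =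
   (n`!%:R / m.+1%:R ^+ n.+1)%:E)%E.
Proof.
set f : R -> R := fun x => x ^+ m * (- ln x) ^+ n.
have mf (D : set R) : measurable_fun D f by exact: measurable_expr_ln.
rewrite -(integral_itv_bndoo false false); last first.
  by apply/measurable_EFinP; exact: mf.
pose F k := `[expR (- k.+1%:R), 1%R]%classic : set R.
have FE : \bigcup_k F k = `]0, 1]%classic.
  apply/seteqP; split => x /=.
    move=> [k _]; rewrite /F/= !in_itv/= => /andP[kx ->]; rewrite andbT.
    exact: lt_le_trans (expR_gt0 _) kx.
  rewrite in_itv/= => /andP[x0 x1].
  (* The integer part [k] of [- ln x] satisfies [- ln x < k + 1], that is [e^(-(k+1)) < x]. *)
  exists (Num.truncn (- ln x)) => //; rewrite /F/= in_itv/= x1 andbT.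
  rewrite -[leRHS]lnK ?posrE// ler_expR lerNl.
  exact/ltW/truncnS_gt.
have := @ge0_nondecreasing_set_cvg_integral _ (measurableTypeR R) R F
  (fun x => (f x)%:E) (@lebesgue_measure R).
rewrite FE => /(_ _ _ _ _)/cvg_lim <-//.
- apply/cvg_lim => //.
  have a01 k : 0 < (expR (- k.+1%:R) : R) < 1.
    by rewrite expR_gt0/= -expR0 ltr_expR oppr_lt0.
  rewrite (eq_cvg _ _ (fun k => integral_expr_ln_segment m n (a01 k))).
  under eq_cvg do rewrite -EFinB.
  apply: cvg_EFin; first exact: nearW.
  rewrite -expr_ln_primitive1 -[X in _ --> X]subr0; apply: cvgB; first exact: cvg_cst.
  exact: expr_ln_primitive_cvg0.
- move=> j k jk; apply/subsetPset => x; rewrite /F/= !in_itv/=.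
  move=> /andP[jx ->]; rewrite andbT (le_trans _ jx)// ler_expR lerN2 ler_nat.
  by rewrite ltnS.
- by move=> k; apply: measurable_itv.
- by move=> k; apply/measurable_EFinP; exact: mf.
- move=> k x; rewrite /F/= in_itv/= => /andP[kx x1].
  have x0 : 0 <= x by rewrite (le_trans _ kx)// expR_ge0.
  by rewrite lee_fin mulr_ge0// exprn_ge0// oppr_ge0 ln_le0.
Qed.

(** * Reindexing of the Euler sum and its finiteness for [q > 1] *)

Lemma odd_euler_sum_shift (R : realType) p q :
  odd_euler_sum R p q =
  (\sum_(0 <= n <oo) (odd_harmonic R p n.+1 / (2 * n).+1%:R ^+ q)%:E)%E.
Proof.
rewrite /odd_euler_sum -(@nneseries_addn _ _ 1%N).
  apply: eq_eseriesr => n _.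
  by rewrite addn1 mulnS addSn add1n subn1.
by move=> i; rewrite lee_fin divr_ge0 ?odd_harmonic_ge0// exprn_ge0.
Qed.

(* The decrements of [(odd_harmonic R p n + 1) / (2 * n)] dominate twice the terms. *)
Lemma odd_euler_partial_sum_le (R : realType) p q n : (0 < p)%N -> (1 < q)%N ->
  \sum_(0 <= i < n.+1) odd_harmonic R p i.+1 / (2 * i).+1%:R ^+ q +
    (odd_harmonic R p n.+1 + 1) / (2 * n.+1%:R) <= 2.
Proof.
move=> p0 q1.
elim: n => [|n IHn].
  rewrite big_nat1 odd_harmonicS /odd_harmonic big_geq// muln0 !expr1n; lra.
apply: le_trans IHn; rewrite big_nat_recr//= -addrA lerD2l.
rewrite odd_harmonicS; set H := odd_harmonic R p n.+1.
have H0 : 0 <= H by exact: odd_harmonic_ge0.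
set k := (2 * n.+1).+1%:R.
have k1 : 1 <= k :> R by rewrite ler1n.
(* The worst case is [p = 1], [q = 2]: both powers are replaced by these exponents, leaving an
   inequality between rational functions of [H] and [k]. *)
have xle : (k ^+ p)^-1 <= k^-1.
  by rewrite lef_pV2 ?posrE ?exprn_gt0 ?(lt_le_trans ltr01 k1)// ler_eXnr.
have yle : (k ^+ q)^-1 <= (k ^+ 2)^-1.
  by rewrite lef_pV2 ?posrE ?exprn_gt0 ?(lt_le_trans ltr01 k1)// ler_weXn2l.
have x0 : 0 <= (k ^+ p)^-1 by rewrite invr_ge0 exprn_ge0// (le_trans ler01).
set x := (k ^+ p)^-1 in xle x0 *.
have kE : k = 2 * n.+1%:R + 1 by rewrite /k -natr1 natrM.
have kE' : 2 * n.+2%:R = k + 1 by rewrite kE -[n.+2%:R]natr1; ring.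
have -> : 2 * n.+1%:R = k - 1 by rewrite kE addrK.
rewrite kE'.
have k1' : 1 < k by rewrite kE ltrDr mulr_gt0.
apply: (@le_trans _ _ ((H + x) * (k ^+ 2)^-1 + (H + x + 1) / (k + 1))).
  by rewrite lerD2r ler_wpM2l// addr_ge0.
apply: (@le_trans _ _ ((H + k^-1) * (k ^+ 2)^-1 + (H + k^-1 + 1) / (k + 1))).
  apply: lerD; rewrite ler_wpM2r ?invr_ge0 ?exprn_ge0 ?lerD//; lra.
rewrite -subr_ge0.
have k0 : 0 < k by exact: lt_trans k1'.
(* Over a common denominator the slack has only nonnegative terms in its numerator. *)
rewrite (_ : _ - _ = (H * (k ^+ 3 + k) + (k ^+ 3 + 1)) /
    (k ^+ 3 * (k - 1) * (k + 1))).
  have k3 : 0 <= k ^+ 3 by apply: exprn_ge0; exact: ltW.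
  have k0' : 0 <= k by exact: ltW.
  have k1'' : 0 <= k - 1 by rewrite subr_ge0.
  exact: divr_ge0 (addr_ge0 (mulr_ge0 H0 (addr_ge0 k3 k0')) (addr_ge0 k3 ler01))
    (mulr_ge0 (mulr_ge0 k3 k1'') (addr_ge0 k0' ler01)).
by field; rewrite !gt_eqF// ?subr_gt0 ?addr_gt0.
Qed.

Lemma odd_euler_sum_fin_num (R : realType) p q : (0 < p)%N -> (1 < q)%N ->
  odd_euler_sum R p q \is a fin_num.
Proof.
move=> p0 q1; rewrite odd_euler_sum_shift.
have t0 n : (0 <= (odd_harmonic R p n.+1 / (2 * n).+1%:R ^+ q)%:E)%E.
  by rewrite lee_fin divr_ge0 ?odd_harmonic_ge0// exprn_ge0.
rewrite ge0_fin_numE ?nneseries_ge0//.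
apply: (@le_lt_trans _ _ 2%:E); last by rewrite ltry.
apply: lime_le; first exact: is_cvg_nneseries.
apply: nearW => -[|n]; first by rewrite big_geq// lee_fin.
rewrite sumEFin lee_fin (le_trans _ (@odd_euler_partial_sum_le R p q n p0 q1))//.
by rewrite lerDl divr_ge0 ?addr_ge0 ?odd_harmonic_ge0.
Qed.

(** * Measurability and sign of the integrands *)

Lemma measurable_polylog (R : realType) p (D : set R) (y : R -> R) :
  measurable_fun D y ->
  (forall x, D x -> `|y x| < 1) -> measurable_fun D (fun x => polylog p (y x)).
Proof.
move=> my y1.
apply: (@measurable_fun_cvg _ _ _ _
  (fun n x => series (fun m => y x ^+ m.+1 / m.+1%:R ^+ p) n)) => [n|x Dx].
  rewrite /series/=; apply: measurable_sum => i.
  by apply: measurable_funM => //; exact: measurable_funX.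
exact: polylog_is_cvg (y1 _ Dx).
Qed.

Lemma itv01_denominator_gt0 (R : realType) (x : R) : 0 < x < 1 -> 0 < x * (1 - x ^+ 2).
Proof. by move=> /andP[x0 x1]; rewrite mulr_gt0// subr_gt0 expr_lt1// ltW. Qed.

Lemma measurable_log_weighted (R : realType) n (f : R -> R) :
  measurable_fun (`]0, 1[%classic : set R) f ->
  measurable_fun (`]0, 1[%classic : set R)
    (fun x => (- ln x) ^+ n * f x / (x * (1 - x ^+ 2)) : R).
Proof.
move=> mf; apply: measurable_funM; first apply: measurable_funM => //.
  apply: measurable_funX; apply: measurableT_comp => //.
  by apply: measurable_funTS; exact: measurable_ln.
apply: open_continuous_measurable_fun; first by [].
move=> x; rewrite inE/= in_itv/= => x01.
apply: cvgV; first by rewrite gt_eqF// itv01_denominator_gt0.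
apply: cvgM => //; apply: cvgB; [exact: cvg_cst|exact: exprn_continuous].
Qed.

Lemma log_weighted_ge0 (R : realType) n (x y : R) : 0 < x < 1 -> 0 <= y ->
  0 <= (- ln x) ^+ n * y / (x * (1 - x ^+ 2)).
Proof.
move=> x01 y0; rewrite divr_ge0 ?(ltW (itv01_denominator_gt0 x01))// mulr_ge0//.
by rewrite exprn_ge0// oppr_ge0 ln_le0// ltW//; case/andP: x01.
Qed.

Lemma measurable_polylog01 (R : realType) p :
  measurable_fun (`]0, 1[%classic : set R) (polylog p).
Proof.
apply: (@measurable_polylog R p _ (fun x : R => x)); first exact: measurable_id.
by move=> x; rewrite /= in_itv/= => /andP[x0 x1]; rewrite ger0_norm// ltW.
Qed.

Lemma measurable_polylogN01 (R : realType) p :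
  measurable_fun (`]0, 1[%classic : set R) (fun x => polylog p (- x)).
Proof.
apply: measurable_polylog; first exact: oppr_measurable.
by move=> x; rewrite /= in_itv/= => /andP[x0 x1]; rewrite normrN ger0_norm// ltW.
Qed.

(** * Termwise integration *)

(** With [- ln x] and [- polylog p (- x)] both integrands are nonnegative, so the identity holds in
    the extended reals without any finiteness assumption. *)
Lemma integral_log_weighted_polylog (R : realType) p n :
  (\int[@lebesgue_measure R]_(x in `]0%R, 1%R[)
      ((- ln x) ^+ n * polylog p x / (x * (1 - x ^+ 2)))%:E +
   \int[@lebesgue_measure R]_(x in `]0%R, 1%R[)
      ((- ln x) ^+ n * (- polylog p (- x)) / (x * (1 - x ^+ 2)))%:E =
   (2 * n`!%:R)%:E * odd_euler_sum R p n.+1)%E.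
Proof.
have mD : measurable (`]0%R, 1%R[%classic : set (measurableTypeR R)).
  exact: measurable_itv.
have itv01 (x : R) : (`]0%R, 1%R[%classic : set R) x -> 0 < x < 1.
  by rewrite /= in_itv.
rewrite -ge0_integralD//; last 4 first.
- move=> x /itv01 x01; rewrite lee_fin log_weighted_ge0// polylog_ge0//.
  by case/andP: x01 => /ltW-> ->.
- apply/measurable_EFinP; apply: measurable_log_weighted.
  exact: measurable_polylog01.
- move=> x /itv01 x01; rewrite lee_fin log_weighted_ge0// oppr_ge0 polylogN_le0//.
  by case/andP: x01 => /ltW-> ->.
- apply/measurable_EFinP; apply: measurable_log_weighted.
  apply: measurableT_comp; first exact: oppr_measurable.
  exact: measurable_polylogN01.
pose t k (x : R) := 2 * odd_harmonic R p k.+1 * (x ^+ (2 * k) * (- ln x) ^+ n).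
have h0 (x : R) : 0 < x < 1 -> 0 <= (- ln x) ^+ n.
  by move=> /andP[x0 x1]; rewrite exprn_ge0// oppr_ge0 ln_le0// ltW.
have tn0 k x : (`]0%R, 1%R[%classic : set R) x -> 0 <= x ^+ (2 * k) * (- ln x) ^+ n.
  move=> /itv01 x01; rewrite mulr_ge0 ?h0// exprn_ge0//.
  by case/andP: x01 => /ltW.
(* Pointwise on the open interval, the sum of the integrands is the generating function times the
   logarithmic weight. *)
transitivity (\int[@lebesgue_measure R]_(x in `]0%R, 1%R[)
    (\sum_(0 <= k <oo) (t k x)%:E))%E.
  apply: eq_integral => x; rewrite inE => /itv01 x01.
  apply/esym/cvg_lim => //.
  rewrite -EFinD.
  have sumE m : (\sum_(0 <= k < m) (t k x)%:E =
      ((\sum_(0 <= k < m) (2 * odd_harmonic R p k.+1 * x ^+ (2 * k))) *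
        (- ln x) ^+ n)%R%:E)%E.
    rewrite sumEFin mulr_suml; congr EFin; apply: eq_bigr => k _.
    by rewrite /t mulrA.
  rewrite (eq_cvg _ _ sumE); apply: cvg_EFin; first exact: nearW.
  rewrite [X in _ --> X](_ : _ = (polylog p x - polylog p (- x)) /
      (x * (1 - x ^+ 2)) * (- ln x) ^+ n); last by ring.
  by apply: cvgM; [exact: polylog_difference_cvg|exact: cvg_cst].
rewrite integral_nneseries//; last 2 first.
- by move=> k; apply/measurable_EFinP; apply: measurable_funM => //;
  exact: measurable_expr_ln.
- move=> k x Dx; rewrite lee_fin; apply: mulr_ge0; last exact: tn0.
  by rewrite mulr_ge0// odd_harmonic_ge0.
rewrite odd_euler_sum_shift -nneseriesZl; last first.
  by move=> i _; rewrite lee_fin divr_ge0 ?odd_harmonic_ge0// exprn_ge0.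
apply: eq_eseriesr => k _.
under eq_integral do rewrite /t EFinM.
rewrite ge0_integralZl_EFin//; last 3 first.
- by move=> x Dx; rewrite lee_fin tn0.
- by apply/measurable_EFinP; exact: measurable_expr_ln.
- by rewrite mulr_ge0// odd_harmonic_ge0.
(* The moment with [m = 2 * k] supplies the odd denominator [m + 1 = 2 * k + 1]. *)
rewrite integral_expr_ln -!EFinM; congr EFin; ring.
Qed.

(** * Restoring the signs and conclusion *)

(** Since [f] has constant sign, no [oo - oo] can arise, and a factor [-1] leaves the integral even
    when its value is infinite. *)
Lemma integral_signM (R : realType) k (D : set R) (f : R -> R) :
  (forall x, D x -> 0 <= f x) ->
  (\int[@lebesgue_measure R]_(x in D) ((-1) ^+ k * f x)%:E =
   ((-1) ^+ k)%:E * \int[@lebesgue_measure R]_(x in D) (f x)%:E)%E.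
Proof.
move=> f0; rewrite -signr_odd; case: (odd k); last first.
  by rewrite mul1e; apply: eq_integral => x _; rewrite mul1r.
rewrite expr1 EFinN mulN1e -integral_ge0N//.
by apply: eq_integral => x _; rewrite mulN1r EFinN.
Qed.

Lemma integrable_signM (R : realType) k (D : set R) (f : R -> R) :
  measurable D -> measurable_fun D f -> (forall x, D x -> 0 <= f x) ->
  (\int[@lebesgue_measure R]_(x in D) (f x)%:E)%E \is a fin_num ->
  (@lebesgue_measure R).-integrable D (fun x => ((-1) ^+ k * f x)%:E).
Proof.
move=> mD mf f0 ffin; apply/integrableP; split.
  by apply/measurable_EFinP; apply: measurable_funM.
suff -> : (\int[@lebesgue_measure R]_(x in D) `|((-1) ^+ k * f x)%:E| =
    \int[@lebesgue_measure R]_(x in D) (f x)%:E)%E.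
  by rewrite -ge0_fin_numE// integral_ge0// => x Dx; rewrite lee_fin f0.
apply: eq_integral => x; rewrite inE => Dx.
by rewrite abse_EFin normrM normr_sign mul1r ger0_norm// f0.
Qed.

Theorem theorem5p5 (R : realType) (p q : nat) (hp : (0 < p)%N) (hq : (0 < q)%N) :
  (odd_euler_sum R p q =
    ((-1) ^+ q / (2 * (q.-1)`!%:R))%:E *
    (\int[@lebesgue_measure R]_(x in `]0%R, 1%R[)
        (ln x ^+ q.-1 * polylog p (- x) / (x * (1 - x ^+ 2)))%:E
     - \int[@lebesgue_measure R]_(x in `]0%R, 1%R[)
        (ln x ^+ q.-1 * polylog p x / (x * (1 - x ^+ 2)))%:E))%E
  /\ ((1 < q)%N ->
      [/\ odd_euler_sum R p q \is a fin_num,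
          (@lebesgue_measure R).-integrable `]0, 1[
            (fun x => (ln x ^+ q.-1 * polylog p (- x) / (x * (1 - x ^+ 2)))%:E)
        & (@lebesgue_measure R).-integrable `]0, 1[
            (fun x => (ln x ^+ q.-1 * polylog p x / (x * (1 - x ^+ 2)))%:E)]).
Proof.
case: q hq => // n _; rewrite [n.+1.-1]/=.
(* [a] and [b] are the absolute values of the two integrands on the open interval. *)
set a := fun x : R => (- ln x) ^+ n * polylog p x / (x * (1 - x ^+ 2)).
set b := fun x : R => (- ln x) ^+ n * (- polylog p (- x)) / (x * (1 - x ^+ 2)).
have lnE x : ln x ^+ n = (-1) ^+ n * (- ln x) ^+ n :> R.
  by rewrite -exprMn mulN1r opprK.
have faE x : ln x ^+ n * polylog p x / (x * (1 - x ^+ 2)) = (-1) ^+ n * a x.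
  by rewrite /a lnE !mulrA.
have fbE x :
    ln x ^+ n * polylog p (- x) / (x * (1 - x ^+ 2)) = (-1) ^+ n.+1 * b x.
  by rewrite /b lnE [_ ^+ n.+1]exprS; ring.
(* Both terms of the difference carry the sign [(-1) ^+ n.+1], so it factors out even if [A] and [B]
   are infinite. *)
have sign_addE (A B : \bar R) : (0 <= A -> 0 <= B ->
    ((-1) ^+ n.+1)%:E * B - ((-1) ^+ n)%:E * A = ((-1) ^+ n.+1)%:E * (A + B))%E.
  move=> A0 B0; rewrite [(A + B)%E]addeC ge0_muleDr//; congr (_ + _)%E.
  by rewrite exprS mulN1r EFinN mulNe.
(* Finiteness of the Euler sum passes to [A + B], hence to each of the two integrals. *)
have fin_numAB (A B : \bar R) : (A + B = (2 * n`!%:R)%:E * odd_euler_sum R p n.+1 ->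
    0 <= A -> 0 <= B -> odd_euler_sum R p n.+1 \is a fin_num ->
    A \is a fin_num /\ B \is a fin_num)%E.
  move=> AB A0 B0 fin.
  have : (A + B)%E \is a fin_num by rewrite AB fin_numM.
  by rewrite fin_numD => /andP[].
have mD : measurable (`]0%R, 1%R[%classic : set (measurableTypeR R)).
  exact: measurable_itv.
have a0 x : (`]0%R, 1%R[%classic : set R) x -> 0 <= a x.
  rewrite /= in_itv/= => x01; rewrite log_weighted_ge0// polylog_ge0//.
  by case/andP: x01 => /ltW-> ->.
have b0 x : (`]0%R, 1%R[%classic : set R) x -> 0 <= b x.
  rewrite /= in_itv/= => x01; rewrite log_weighted_ge0// oppr_ge0 polylogN_le0//.
  by case/andP: x01 => /ltW-> ->.
have ma : measurable_fun (`]0, 1[%classic : set R) a.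
  by apply: measurable_log_weighted; exact: measurable_polylog01.
have mb : measurable_fun (`]0, 1[%classic : set R) b.
  apply: measurable_log_weighted; apply: measurableT_comp.
    exact: oppr_measurable.
  exact: measurable_polylogN01.
have IE := integral_log_weighted_polylog R p n; rewrite -/a -/b in IE.
set A := (\int[_]_(x in _) _)%E in IE; set B := (\int[_]_(x in _) _)%E in IE.
have A0 : (0 <= A)%E by apply: integral_ge0 => x Dx; rewrite lee_fin a0.
have B0 : (0 <= B)%E by apply: integral_ge0 => x Dx; rewrite lee_fin b0.
have f0 : 2 * n`!%:R != 0 :> R by rewrite mulf_neq0 ?pnatr_eq0 -?lt0n ?fact_gt0.
split.
  under eq_integral do rewrite fbE.
  under [X in (_ - X)%E]eq_integral do rewrite faE.
  rewrite !integral_signM// -/A -/B.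
  rewrite sign_addE//.
  rewrite IE !muleA -!EFinM [X in X%:E](_ : _ = 1) ?mul1e//.
  by rewrite mulrAC divfK// -expr2 sqrr_sign.
move=> n0; have fin := odd_euler_sum_fin_num R hp n0.
have [Afin Bfin] := fin_numAB _ _ IE A0 B0 fin.
split=> //.
  apply: eq_integrable (integrable_signM n.+1 mD mb b0 Bfin) => // x _.
  by rewrite fbE.
apply: eq_integrable (integrable_signM n mD ma a0 Afin) => // x _.
by rewrite faE.
Qed.
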